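(* Let $n,q$ be positive integers with $q<n$, let $A\in\mathbb{R}^{n\times n}$ and $B\in\mathbb{R}^{n\times q}$. Assume that all eigenvalues of $A$ lie in the open left half plane and that $W(A)$ has nonempty intersection with the open right half plane. Assume that $A+A^T$ is negative definite on the kernel of $B^T$. Let $$\mathcal{M}=\begin{bmatrix} -(A+A^T) & B\\ B^T & 0\end{bmatrix}\in\mathbb{R}^{(n+q)\times(n+q)},$$ and let $\mathcal{M}=Q\,\mathrm{blkdiag}(\Lambda_+,\Lambda_-)\,Q^T$ be the eigendecomposition of $\mathcal{M}$, with $Q$ real orthogonal, where $\Lambda_+\in\mathbb{R}^{n\times n}$ is diagonal containing the $n$ positive eigenvalues of $\mathcal{M}$ and $\Lambda_-\in\mathbb{R}^{q\times q}$ is diagonal containing the $q$ negative eigenvalues of $\mathcal{M}$. Partition $$Q=\begin{bmatrix} Q_{11} & Q_{12}\\ Q_{21} & Q_{22}\end{bmatrix}$$ with $Q_{11}\in\mathbb{R}^{n\times n}$ nonsingular. Then for any $H_2\in\mathbb{R}^{q\times n}$ such that $I-Q_{12}H_2$ is nonsingular and $\alpha=\|H_2(I-Q_{12}H_2)^{-1}Q_{11}\|^2$ satisfies $$\min\lambda(\Lambda_+)>\alpha\,\max\lambda(|\Lambda_-|),$$ the feedback matrix $$K=Q_{21}Q_{11}^{-1}+(Q_{22}-Q_{21}Q_{11}^{-1}Q_{12})H_2$$ is dissipating.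
   Context: For $M\in\mathbb{R}^{n\times n}$, the field of values is $W(M)=\{x^*Mx : x\in\mathbb{C}^n,\ \|x\|=1\}$ with $\|x\|$ the Euclidean norm. A matrix $K\in\mathbb{R}^{q\times n}$ is called dissipating (a dissipating feedback matrix for the pair $(A,B)$) if $W(A-BK)$ is contained in the open left half complex plane. ''Negative definite on the kernel of $B^T$'' means $x^T(A+A^T)x<0$ for every nonzero $x\in\mathbb{R}^n$ with $B^Tx=0$. The matrix norm $\|\cdot\|$ is the norm induced by the Euclidean vector norm (spectral norm), $\lambda(\cdot)$ denotes the set of eigenvalues, and $|\Lambda_-|$ is the diagonal matrix of absolute values of the entries of $\Lambda_-$. *)

(* Defs.v *)
From HB Require Import structures.
From mathcomp Require Export all_boot all_order all_algebra.
From mathcomp Require Export all_classical all_reals.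
From mathcomp Require Export complex.

Set Implicit Arguments.
Unset Strict Implicit.
Unset Printing Implicit Defensive.

Import Order.TTheory GRing.Theory Num.Theory.
Local Open Scope classical_set_scope.
Local Open Scope sesquilinear_scope.
Local Open Scope ring_scope.

Definition cplx_mx (R : realType) (m n : nat) (M : 'M[R]_(m, n)) :
    'M[R[i]]_(m, n) :=
  map_mx (real_complex R) M.

Definition enorm (R : realType) (n : nat) (x : 'cV[R]_n) : R :=
  Num.sqrt (\sum_(i < n) x i 0 ^+ 2).

(* Its value is a nonnegative real, seen as an element of [C]. *)
Definition cenorm (C : numClosedFieldType) (n : nat) (x : 'cV[C]_n) : C :=
  sqrtC (\sum_(i < n) `|x i 0| ^+ 2).

(* The matrix norm induced by the Euclidean norm.  For [0 < n] the set is
   nonempty and bounded, so that [sup] is its genuine supremum. *)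
Definition spectral_norm (R : realType) (m n : nat) (M : 'M[R]_(m, n)) : R :=
  sup [set enorm (M *m x) | x in [set x : 'cV[R]_n | enorm x = 1]].

(* W(M) = { x^* M x : x in C^n, ||x|| = 1 }. *)
Definition field_of_values (R : realType) (n : nat) (M : 'M[R]_n) :
    set R[i] :=
  [set (x ^t* *m cplx_mx M *m x) 0 0 | x in [set x : 'cV[R[i]]_n | cenorm x = 1]].

Definition open_left_half_plane (R : realType) : set R[i] :=
  [set z | complex.Re z < 0].

Definition open_right_half_plane (R : realType) : set R[i] :=
  [set z | 0 < complex.Re z].

Definition dissipating (R : realType) (n q : nat)
    (A : 'M[R]_n) (B : 'M[R]_(n, q)) (K : 'M[R]_(q, n)) : Prop :=
  field_of_values (A - B *m K) `<=` @open_left_half_plane R.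

(* [eigenvalue] of the library only considers eigenvalues in the coefficient
   field: the complex spectrum of a real matrix [M] is
   [spectrum (cplx_mx M)]. *)
Definition spectrum (F : fieldType) (n : nat) (M : 'M[F]_n) : set F :=
  [set a | eigenvalue M a].

(* The least and the greatest element of [S], with default value [0] when there
   is none. *)
Definition set_min (R : realType) (S : set R) : R := xget 0 (S `&` lbound S).
Definition set_max (R : realType) (S : set R) : R := xget 0 (S `&` ubound S).

Definition neg_def_on_kernel (R : realType) (n q : nat)
    (S : 'M[R]_n) (B : 'M[R]_(n, q)) : Prop :=
  forall x : 'cV[R]_n, x != 0 -> B^T *m x = 0 -> (x^T *m S *m x) 0 0 < 0.

Definition saddle_mx (R : realType) (n q : nat)
    (A : 'M[R]_n) (B : 'M[R]_(n, q)) : 'M[R]_(n + q) :=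
  block_mx (- (A + A^T)) B B^T 0.

Definition blkdiag (R : realType) (n q : nat) (L1 : 'M[R]_n) (L2 : 'M[R]_q) :
    'M[R]_(n + q) :=
  block_mx L1 0 0 L2.

Definition orthogonal_mx (R : realType) (n : nat) (Q : 'M[R]_n) : Prop :=
  Q^T *m Q = 1%:M.

(* Main.v *)
Require Import Defs.
From mathcomp Require Import ring lra.

Import Order.TTheory GRing.Theory Num.Theory.
Local Open Scope classical_set_scope.
Local Open Scope ring_scope.

(** Write [S = A + A^T] and let [M] be the saddle-point matrix of [A] and [B].
    For any feedback [K], evaluating [M] on the graph of [K] gives
      [(x; Kx)^T M (x; Kx) = - x^T S x + 2 x^T B K x = - 2 x^T (A - BK) x],
    so that [K] is dissipating as soon as [M] is positive on every nonzero
    vector of the graph of [K] (lemma [quad_form_saddle]; passing from real to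
    complex [x] costs nothing because [Re (x^* N x)] is the sum of the real
    quadratic forms at the real and imaginary parts of [x], see
    [Re_quad_form]).

    The given [K] is the one whose graph, in the eigenbasis
    [(x; y) = Q (u; v)], is cut out by [v = H2 x].  Indeed the upper block row
    gives [u = Q11^-1 (I - Q12 H2) x], and substituting it into the lower one
    gives [y = Q21 u + Q22 v = K x] (lemma [graph_in_eigenbasis]).  Since both
    [Q11] and [I - Q12 H2] are invertible, [u] parametrizes the graph,
    [v = N u] with [N = H2 (I - Q12 H2)^-1 Q11], and [M] becomes
      [u^T L_+ u + v^T L_- v >= min L_+ |u|^2 - max |L_-| |N u|^2
                             >= (min L_+ - alpha max |L_-|) |u|^2],
    which is positive for [u <> 0] by the gap hypothesis. *)

Section SaddlePointForms.
Set Implicit Arguments.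
Unset Strict Implicit.
Unset Printing Implicit Defensive.

Variable R : realType.

Definition quad_form n (S : 'M[R]_n) (x : 'cV[R]_n) : R :=
  (x^T *m S *m x) 0 0.

Lemma mulmx3E (C : comNzRingType) n (u : 'rV[C]_n) (S : 'M[C]_n)
    (v : 'cV[C]_n) :
  (u *m S *m v) 0 0 = \sum_j \sum_i u 0 i * S i j * v j 0.
Proof.
by rewrite mxE; apply: eq_bigr => j _; rewrite mxE mulr_suml.
Qed.

(** For [x = a + ib] the cross terms [i (a^T S b - b^T S a)] are purely
    imaginary. *)
Lemma Re_quad_form n (S : 'M[R]_n) (x : 'cV[R[i]]_n) :
  complex.Re (((x ^t*)%sesqui *m cplx_mx S *m x) 0 0) =
  quad_form S (map_mx (@complex.Re R) x) +
  quad_form S (map_mx (@complex.Im R) x).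
Proof.
have ReD : {morph @complex.Re R : z w / z + w} by case=> ? ? [].
have Re0 : complex.Re (0 : R[i]) = 0 by [].
rewrite /quad_form !mulmx3E (big_morph _ ReD Re0) -big_split /=.
apply: eq_bigr => j _; rewrite (big_morph _ ReD Re0) -big_split /=.
apply: eq_bigr => i _; rewrite !mxE.
by case: (x i 0) (x j 0) => [a b] [c d] /=; ring.
Qed.

Lemma field_of_values_lhp n (S : 'M[R]_n) :
  (forall x : 'cV[R]_n, x != 0 -> quad_form S x < 0) ->
  field_of_values S `<=` @open_left_half_plane R.
Proof.
move=> Sneg _ [x /= x1 <-]; rewrite /open_left_half_plane /= Re_quad_form.
have Snpos y : quad_form S y <= 0.
  have [->|/Sneg/ltW //] := eqVneq y 0.
  by rewrite /quad_form mulmx0 mxE.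
set a := map_mx _ x; set b := map_mx _ x.
have [a0|/Sneg alt] := eqVneq a 0; last by rewrite ltr_wnDr.
have [b0|/Sneg blt] := eqVneq b 0; last by rewrite ltr_wnDl.
have x0 : x = 0.
  apply/colP => i; move: a0 b0 => /colP/(_ i) + /colP/(_ i).
  by rewrite !mxE; case: (x i 0) => ? ? /= -> ->.
move: x1; rewrite /cenorm x0 big1 => [/eqP|i _].
  by rewrite sqrtC0 eq_sym oner_eq0.
by rewrite mxE normr0 expr0n.
Qed.

Lemma quad_form_block_mx n q (S : 'M[R]_n) (B : 'M[R]_(n, q))
    (C : 'M[R]_(q, n)) (D : 'M[R]_q) (x : 'cV[R]_n) (y : 'cV[R]_q) :
  quad_form (block_mx S B C D) (col_mx x y) =
  quad_form S x + (y^T *m C *m x) 0 0 + ((x^T *m B *m y) 0 0 + quad_form D y).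
Proof.
by rewrite /quad_form tr_col_mx mul_row_block mul_row_col !mulmxDl !mxE.
Qed.

(** The identity behind the method: the saddle-point matrix restricted to the
    graph of a feedback [K] is minus twice the closed-loop form. *)
Lemma quad_form_saddle n q (A : 'M[R]_n) (B : 'M[R]_(n, q)) (K : 'M[R]_(q, n))
    (x : 'cV[R]_n) :
  quad_form (saddle_mx A B) (col_mx x (K *m x)) =
  - 2 * quad_form (A - B *m K) x.
Proof.
have trxx (N : 'M[R]_1) : N^T 0 0 = N 0 0 by rewrite mxE.
have AT : (x^T *m A^T *m x) 0 0 = (x^T *m A *m x) 0 0.
  by rewrite -[LHS]trxx !trmx_mul !trmxK mulmxA.
have BT : ((K *m x)^T *m B^T *m x) 0 0 = (x^T *m B *m (K *m x)) 0 0.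
  by rewrite -[LHS]trxx !trmx_mul !trmxK mulmxA.
rewrite quad_form_block_mx BT /quad_form mulmx0 mul0mx.
rewrite !(mulmxN, mulNmx, mulmxDr, mulmxDl).
move: AT; rewrite !mulmxA.
set a := _ *m A *m x; set a' := _ *m A^T *m x; set b := _ *m K *m x.
rewrite !mxE => ->; ring.
Qed.

Lemma quad_form_orthogonal n (Q D : 'M[R]_n) (w : 'cV[R]_n) :
  orthogonal_mx Q -> quad_form (Q *m D *m Q^T) (Q *m w) = quad_form D w.
Proof.
move=> QTQ; have QK v : Q^T *m (Q *m v) = v by rewrite mulmxA QTQ mul1mx.
by rewrite /quad_form trmx_mul -!mulmxA QK (mulmxA Q^T Q) QTQ mul1mx.
Qed.

Lemma enorm_sqr n (x : 'cV[R]_n) : enorm x ^+ 2 = \sum_i x i 0 ^+ 2.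
Proof. by rewrite sqr_sqrtr // sumr_ge0 // => i _; rewrite sqr_ge0. Qed.

Lemma enorm_ge0 n (x : 'cV[R]_n) : 0 <= enorm x.
Proof. exact: sqrtr_ge0. Qed.

Lemma enorm_eq0 n (x : 'cV[R]_n) : (enorm x == 0) = (x == 0).
Proof.
apply/eqP/eqP => [x0|->]; last first.
  by rewrite /enorm big1 ?sqrtr0 // => i _; rewrite mxE expr0n.
have /eqP := enorm_sqr x; rewrite x0 expr0n eq_sym psumr_eq0 => [/allP xi0|i _].
  apply/colP => i; apply/eqP; rewrite mxE -sqrf_eq0.
  exact: xi0 (mem_index_enum i).
exact: sqr_ge0.
Qed.

Lemma enormZ n (c : R) (x : 'cV[R]_n) : enorm (c *: x) = `|c| * enorm x.
Proof.
rewrite /enorm -sqrtr_sqr -sqrtrM ?sqr_ge0 // mulr_sumr.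
by congr Num.sqrt; apply: eq_bigr => i _; rewrite mxE exprMn.
Qed.

Lemma norm_entry_le_enorm n (x : 'cV[R]_n) i : `|x i 0| <= enorm x.
Proof.
rewrite -(ler_pXn2r (ltn0Sn 1)) ?nnegrE ?enorm_ge0 // enorm_sqr.
rewrite real_normK ?num_real // (bigD1 i) //= lerDl sumr_ge0 // => j _.
exact: sqr_ge0.
Qed.

(** On the unit sphere every entry of [x] is at most [1] in absolute value, so
    the entries of [M x] are bounded by the absolute row sums of [M]; hence the
    supremum that defines the spectral norm is finite. *)
Lemma enorm_mulmx_bounded m n (M : 'M[R]_(m, n)) :
  has_ubound [set enorm (M *m x) | x in [set x : 'cV[R]_n | enorm x = 1]].
Proof.
exists (Num.sqrt (\sum_i (\sum_j `|M i j|) ^+ 2)) => _ [x /= x1 <-].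
apply: ler_wsqrtr; apply: ler_sum => i _.
rewrite -real_normK ?num_real // ler_pXn2r ?nnegrE ?sumr_ge0 //.
rewrite mxE; apply: le_trans (ler_norm_sum _ _ _) _; apply: ler_sum => j _.
by rewrite normrM ler_piMr // -x1 norm_entry_le_enorm.
Qed.

Lemma enorm_mulmx_le m n (M : 'M[R]_(m, n)) (x : 'cV[R]_n) :
  enorm (M *m x) <= spectral_norm M * enorm x.
Proof.
have [->|x0] := eqVneq x 0.
  have enorm0 k : enorm (0 : 'cV[R]_k) = 0 by apply/eqP; rewrite enorm_eq0.
  by rewrite mulmx0 !enorm0 mulr0.
have nx : 0 < enorm x by rewrite lt_def enorm_eq0 x0 enorm_ge0.
pose u := (enorm x)^-1 *: x.
have u1 : enorm u = 1.
  by rewrite enormZ ger0_norm ?invr_ge0 ?enorm_ge0 // mulVf ?gt_eqF.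
have Mu : enorm (M *m u) = (enorm x)^-1 * enorm (M *m x).
  by rewrite -scalemxAr enormZ ger0_norm // invr_ge0 enorm_ge0.
rewrite -ler_pdivrMr // mulrC -Mu.
apply: ub_le_sup; first exact: enorm_mulmx_bounded.
by exists u.
Qed.

Lemma spectrum_diag_mx n (d : 'rV[R]_n) (a : R) :
  spectrum (diag_mx d) a <-> exists i, a = d 0 i.
Proof.
rewrite /spectrum /=; split=> [/eigenvalueP[v vd v0]|[i ->]].
  have /existsP[i vi] : [exists i, v 0 i != 0].
    rewrite -negb_forall; apply: contraNN v0 => /forallP v0.
    by apply/eqP/rowP => i; rewrite mxE (eqP (v0 i)).
  exists i; move/rowP/(_ i): vd; rewrite mul_mx_diag !mxE mulrC.
  by move/(mulIf vi).
apply/eigenvalueP; exists (delta_mx 0 i).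
  apply/rowP => j; rewrite mul_mx_diag !mxE eqxx /=.
  by case: eqP => [->|_]; rewrite ?mulr1 ?mul1r ?mulr0 ?mul0r.
by apply/eqP => /rowP/(_ i); rewrite !mxE !eqxx /= => /eqP; rewrite oner_eq0.
Qed.

(** The minimum is attained because the spectrum is finite and, in the presence
    of an index [i], nonempty; so [set_min] does not take its default value. *)
Lemma set_min_spectrum_diag_le n (d : 'rV[R]_n) i :
  set_min (spectrum (diag_mx d)) <= d 0 i.
Proof.
have dS j : spectrum (diag_mx d) (d 0 j) by apply/spectrum_diag_mx; exists j.
rewrite /set_min; case: xgetP => [m _ [_ lbm]|noMin]; first exact: lbm.
case: (@arg_minP _ _ _ i xpredT (fun j => d 0 j) isT) => j _ jmin.
case: (noMin (d 0 j)); split=> // _ /spectrum_diag_mx[k ->]; exact: jmin.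
Qed.

Lemma set_max_spectrum_diag_ge n (d : 'rV[R]_n) i :
  d 0 i <= set_max (spectrum (diag_mx d)).
Proof.
have dS j : spectrum (diag_mx d) (d 0 j) by apply/spectrum_diag_mx; exists j.
rewrite /set_max; case: xgetP => [m _ [_ ubm]|noMax]; first exact: ubm.
case: (@arg_maxP _ _ _ i xpredT (fun j => d 0 j) isT) => j _ jmax.
case: (noMax (d 0 j)); split=> // _ /spectrum_diag_mx[k ->]; exact: jmax.
Qed.

Lemma quad_form_diag_mx n (d : 'rV[R]_n) (x : 'cV[R]_n) :
  quad_form (diag_mx d) x = \sum_i d 0 i * x i 0 ^+ 2.
Proof.
rewrite /quad_form mul_mx_diag mxE; apply: eq_bigr => i _; rewrite !mxE; ring.
Qed.

Lemma quad_form_diag_mx_ge n (d : 'rV[R]_n) (c : R) (x : 'cV[R]_n) :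
  (forall i, c <= d 0 i) -> c * enorm x ^+ 2 <= quad_form (diag_mx d) x.
Proof.
move=> cd; rewrite quad_form_diag_mx enorm_sqr mulr_sumr; apply: ler_sum => i _.
by rewrite ler_wpM2r ?sqr_ge0.
Qed.

(** The negative block costs at most [max |L_-| |N u|^2], hence at most
    [|N|^2 max |L_-| |u|^2], which the gap keeps below the gain
    [min L_+ |u|^2] of the positive block.  Multiplying the norm bound by
    [max |L_-|] requires [0 <= max |L_-|], which is where [0 < q] enters. *)
Lemma quad_form_blkdiag_gt0 n q (lp : 'rV[R]_n) (lm : 'rV[R]_q)
    (N : 'M[R]_(q, n)) (u : 'cV[R]_n) :
  (0 < q)%N ->
  spectral_norm N ^+ 2 *
    set_max (spectrum (map_mx Num.norm (diag_mx lm))) <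
    set_min (spectrum (diag_mx lp)) ->
  u != 0 ->
  0 < quad_form (blkdiag (diag_mx lp) (diag_mx lm)) (col_mx u (N *m u)).
Proof.
move=> q_gt0.
have -> : map_mx Num.norm (diag_mx lm) = diag_mx (map_mx Num.norm lm).
  by apply/matrixP => i j; rewrite !mxE normrMn.
set mp := set_min _; set mm := set_max _ => gap u0.
have lm_le j : `|lm 0 j| <= mm.
  by have := set_max_spectrum_diag_ge (map_mx Num.norm lm) j; rewrite mxE.
have mm0 : 0 <= mm := le_trans (normr_ge0 _) (lm_le (Ordinal q_gt0)).
have posU := @quad_form_diag_mx_ge _ lp mp u (set_min_spectrum_diag_le lp).
have lowN : - mm * enorm (N *m u) ^+ 2 <= quad_form (diag_mx lm) (N *m u).
  by apply: quad_form_diag_mx_ge => j; have := lm_le j; rewrite ler_norml => /andP[].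
have nrmN : enorm (N *m u) ^+ 2 <= spectral_norm N ^+ 2 * enorm u ^+ 2.
  rewrite -exprMn lerXn2r ?nnegrE ?enorm_ge0 ?enorm_mulmx_le //.
  exact: le_trans (enorm_ge0 _) (enorm_mulmx_le _ _).
have u_gt0 : 0 < enorm u ^+ 2 by rewrite exprn_gt0 // lt_def enorm_eq0 u0 enorm_ge0.
rewrite quad_form_block_mx !mulmx0 !mul0mx !mxE addr0 add0r.
have := ler_wpM2l mm0 nrmN; have := gap; rewrite -(ltr_pM2r u_gt0).
by move: posU lowN; rewrite mulNr mulrA [mm * _ ^+ 2]mulrC; lra.
Qed.

(** In the coordinates given by [Q], the graph of the feedback consists of the
    vectors whose second component is [H2 x].  The formula for [K] is what
    results from eliminating the first component between the block rows. *)
Lemma graph_in_eigenbasis n q (Q11 : 'M[R]_n) (Q12 : 'M[R]_(n, q))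
    (Q21 : 'M[R]_(q, n)) (Q22 : 'M[R]_q) (H : 'M[R]_(q, n)) (x : 'cV[R]_n) :
  Q11 \in unitmx ->
  col_mx x ((Q21 *m invmx Q11 + (Q22 - Q21 *m invmx Q11 *m Q12) *m H) *m x) =
  block_mx Q11 Q12 Q21 Q22 *m
    col_mx (invmx Q11 *m ((1%:M - Q12 *m H) *m x)) (H *m x).
Proof.
move=> Q11u; rewrite mul_block_col mulKVmx //; congr col_mx.
  by rewrite mulmxBl mul1mx -mulmxA subrK.
rewrite !(mulmxDl, mulmxBl, mulNmx, mulmxBr, mul1mx, mulmxA, mulmxN, mulmxDr).
by rewrite -!addrA; congr (_ + _); rewrite addrC.
Qed.

End SaddlePointForms.

Theorem proposition3p3 (R : realType) (n q : nat)
  (hn : (0 < n)%N) (hq : (0 < q)%N) (hqn : (q < n)%N)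
  (A : 'M[R]_n) (B : 'M[R]_(n, q))
  (hstable : spectrum (cplx_mx A) `<=` @open_left_half_plane R)
  (hW : field_of_values A `&` @open_right_half_plane R !=set0)
  (hker : neg_def_on_kernel (A + A^T) B)
  (Q : 'M[R]_(n + q)) (lp : 'rV[R]_n) (lm : 'rV[R]_q)
  (hQ : orthogonal_mx Q)
  (hlp : forall i : 'I_n, 0 < lp 0 i)
  (hlm : forall j : 'I_q, lm 0 j < 0)
  (hM : saddle_mx A B = Q *m blkdiag (diag_mx lp) (diag_mx lm) *m Q^T)
  (Q11 : 'M[R]_n) (Q12 : 'M[R]_(n, q)) (Q21 : 'M[R]_(q, n)) (Q22 : 'M[R]_q)
  (hpart : Q = block_mx Q11 Q12 Q21 Q22)
  (hQ11 : Q11 \in unitmx)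
  (H2 : 'M[R]_(q, n))
  (hH2 : 1%:M - Q12 *m H2 \in unitmx)
  (alpha : R)
  (halpha : alpha =
    spectral_norm (H2 *m invmx (1%:M - Q12 *m H2) *m Q11) ^+ 2)
  (hgap : set_min (spectrum (diag_mx lp)) >
    alpha * set_max (spectrum (map_mx Num.norm (diag_mx lm)))) :
  dissipating A B
    (Q21 *m invmx Q11 + (Q22 - Q21 *m invmx Q11 *m Q12) *m H2).
Proof.
apply: field_of_values_lhp => x x0.
set K := (_ + _ : 'M[R]_(q, n)); set T := 1%:M - Q12 *m H2.
pose u := invmx Q11 *m (T *m x).
have xu : x = invmx T *m (Q11 *m u) by rewrite mulKVmx // mulKmx.
have u0 : u != 0 by apply: contra_neq x0 => u0; rewrite xu u0 !mulmx0.
have vu : H2 *m x = H2 *m invmx T *m Q11 *m u by rewrite [in LHS]xu !mulmxA.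
suff : 0 < - 2 * quad_form (A - B *m K) x by rewrite mulNr oppr_gt0 pmulr_rlt0.
rewrite -quad_form_saddle hM /K graph_in_eigenbasis // -hpart.
rewrite quad_form_orthogonal // -/T -/u vu.
by apply: quad_form_blkdiag_gt0; rewrite // -halpha.
Qed.
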